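(* Let $\mathcal V=(V,\le,\otimes,k)$ be a commutative quantale with $k=\top$, and let $(X,a,+)$ and $(Y,b,\cdot)$ be $\mathcal V$-monoids. Let $\alpha:Y\times X\to X$ be a monoid action and let $c:(X\times Y)\times(X\times Y)\to V$ be a $\mathcal V$-relation on $X\times Y$ such that $(X\rtimes_\alpha Y,c)$ is a $\mathcal V$-monoid. Then the following are equivalent: (a) $(X,a)\overset{\iota_1}{\hookrightarrow}(X\rtimes_\alpha Y,c)\overset{\pi_2}{\underset{\iota_2}{\rightleftarrows}}(Y,b)$ is a $U$-Schreier split extension of $\mathcal V$-monoids; (b) $a\otimes b\le c\le \mathrm{wlex}$ (pointwise inequalities of functions $(X\times Y)\times(X\times Y)\to V$).
   Context: A quantale $\mathcal V=(V,\le,\otimes,k)$ is a complete lattice $(V,\le)$ with a monoid structure $(V,\otimes,k)$ such that $\otimes$ preserves arbitrary joins in each variable; it is commutative if $\otimes$ is; $\top$ is the top element of $V$. A $\mathcal V$-relation on a set $X$ is a function $a:X\times X\to V$. A $\mathcal V$-category is a pair $(X,a)$ with $a$ a $\mathcal V$-relation that is reflexive ($k\le a(x,x)$) and transitive ($a(x,y)\otimes a(y,z)\le a(x,z)$). A $\mathcal V$-functor $(X,a)\to(Y,b)$ is a map $f$ with $a(x,x')\le b(f(x),f(x'))$. A $\mathcal V$-monoid $(X,a,+)$ is a $\mathcal V$-category $(X,a)$ with a monoid structure $(X,+)$ such that $a(x_1,y_1)\otimes a(x_2,y_2)\le a(x_1+x_2,y_1+y_2)$ for all $x_1,x_2,y_1,y_2\in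 X$. Morphisms of $\mathcal V$-monoids are maps that are both $\mathcal V$-functors and monoid homomorphisms. The monoid $X$ is written additively with unit $0$ (but is not assumed commutative), and $Y$ multiplicatively with unit $1$. A monoid action of $Y$ on $X$ is a map $\alpha:Y\times X\to X$ with $\alpha(1,x)=x$, $\alpha(yy',x)=\alpha(y,\alpha(y',x))$, $\alpha(y,0)=0$, $\alpha(y,x+x')=\alpha(y,x)+\alpha(y,x')$. $X\rtimes_\alpha Y$ is the monoid on $X\times Y$ with $(x_1,y_1)(x_2,y_2)=(x_1+\alpha(y_1,x_2),y_1y_2)$. Also $\iota_1(x)=(x,1)$, $\iota_2(y)=(0,y)$, $\pi_2(x,y)=y$. A $U$-Schreier split extension of $\mathcal V$-monoids is a diagram $(X,a)\overset{\kappa}{\hookrightarrow}(Z,c)\overset{p}{\underset{s}{\rightleftarrows}}(Y,b)$ of $\mathcal V$-monoid morphisms such that $p\circ s=\mathrm{id}_Y$; $\kappa$ is the kernel of $p$ in the category of $\mathcal V$-monoids, i.e. $\kappa$ is an injective monoid homomorphism with image $\{z\in Z\mid p(z)=1\}$ and $a(x,x')=c(\kappa(x),\kappa(x'))$ for all $x,x'\in X$; and there exists a unique set map $q:Z\to X$ with $z=\kappa(q(z))\star s(p(z))$ for all $z\in Z$, where $\star$ is the operation of $Z$. The $\mathcal V$-relations $a\otimes b$ and $\mathrm{wlex}$ on $X\times Y$ are: $(a\otimes b)((x,y),(x',y'))=a(x,x')\otimes b(y,y')$; and $\mathrm{wlex}((x,y),(x',y'))=a(x,x')$ if $y=y'=1$,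 and $=b(y,y')$ otherwise. *)

(* Defs.v *)
From HB Require Import structures.
From mathcomp Require Import all_boot all_order monoid.
From mathcomp Require Import classical_sets.

Set Implicit Arguments.
Unset Strict Implicit.
Unset Printing Implicit Defensive.

Import Order.TTheory.

Local Open Scope classical_set_scope.
Local Open Scope group_scope.

HB.mixin Record isCompleteLattice (d : Order.disp_t) T of Order.TBLattice d T := {
  supremums_nonempty : forall A : set T, supremums A !=set0
}.

#[short(type="completeLatticeType")]
HB.structure Definition CompleteLattice (d : Order.disp_t) :=
  {T of isCompleteLattice d T & Order.TBLattice d T}.

(* The monoid (V, (x), k) of a quantale is the multiplicative monoid
   (V, *, 1) of [monoidType]. The set A below ranges over all subsets of V, the
   empty one included, so that * preserves the bottom element too. *)
HB.mixin Record isQuantale (d : Order.disp_t) V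
    of CompleteLattice d V & Monoid V := {
  mulg_supremumsr : forall (x : V) (A : set V) (s : V),
    supremums A s -> supremums [set x * y | y in A] (x * s);
  mulg_supremumsl : forall (x : V) (A : set V) (s : V),
    supremums A s -> supremums [set y * x | y in A] (s * x)
}.

#[short(type="quantaleType")]
HB.structure Definition Quantale (d : Order.disp_t) :=
  {V of isQuantale d V & CompleteLattice d V & Monoid V}.

Definition vrel (V X : Type) := X -> X -> V.

Section VCategories.
Context {d : Order.disp_t} {V : quantaleType d}.

Record is_vcategory (X : Type) (a : vrel V X) : Prop := IsVCategory {
  vcat_refl : forall x, (1 <= a x x)%O;
  vcat_trans : forall x y z, (a x y * a y z <= a x z)%O
}.

Definition is_vfunctor (X Y : Type) (a : vrel V X) (b : vrel V Y)
    (f : X -> Y) : Prop :=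
  forall x x', (a x x' <= b (f x) (f x'))%O.

(* All monoids are written multiplicatively, including the kernel monoid that
   is usually written (X, +, 0): an [nmodType] would be commutative. *)
Record is_vmonoid (X : monoidType) (a : vrel V X) : Prop := IsVMonoid {
  vmonoid_vcat : is_vcategory a;
  vmonoid_mulg : forall x1 x2 y1 y2,
    (a x1 y1 * a x2 y2 <= a (x1 * x2)%g (y1 * y2)%g)%O
}.

Record is_vmonoid_morphism (X Y : monoidType) (a : vrel V X) (b : vrel V Y)
    (f : X -> Y) : Prop := IsVMonoidMorphism {
  vmorph_vfunctor : is_vfunctor a b f;
  vmorph_monoid : monoid_morphism f
}.

Record is_vmonoid_kernel (X Z Y : monoidType) (a : vrel V X) (c : vrel V Z)
    (kappa : X -> Z) (p : Z -> Y) : Prop := IsVMonoidKernel {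
  vker_monoid : monoid_morphism kappa;
  vker_inj : injective kappa;
  vker_range : range kappa = [set z | p z = 1];
  vker_rel : forall x x', a x x' = c (kappa x) (kappa x')
}.

Record is_uschreier_split_extension (X Z Y : monoidType)
    (a : vrel V X) (c : vrel V Z) (b : vrel V Y)
    (kappa : X -> Z) (p : Z -> Y) (s : Y -> Z) : Prop :=
  IsUSchreierSplitExtension {
  usse_vmonoidX : is_vmonoid a;
  usse_vmonoidZ : is_vmonoid c;
  usse_vmonoidY : is_vmonoid b;
  usse_kappa : is_vmonoid_morphism a c kappa;
  usse_p : is_vmonoid_morphism c b p;
  usse_s : is_vmonoid_morphism b c s;
  usse_ps : p \o s = id;
  usse_kernel : is_vmonoid_kernel a c kappa p;
  usse_q : exists! q : Z -> X, forall z, z = kappa (q z) * s (p z)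
}.

Definition tensor_rel (X Y : Type) (a : vrel V X) (b : vrel V Y) :
    vrel V (X * Y) :=
  fun u v => a u.1 v.1 * b u.2 v.2.

Definition wlex (X : Type) (Y : monoidType) (a : vrel V X) (b : vrel V Y) :
    vrel V (X * Y) :=
  fun u v => if (u.2 == 1) && (v.2 == 1) then a u.1 v.1 else b u.2 v.2.

Definition vrel_le (X : Type) (a b : vrel V X) : Prop :=
  forall x y, (a x y <= b x y)%O.

End VCategories.

Record is_monoid_action (X Y : monoidType) (alpha : Y -> X -> X) : Prop :=
  IsMonoidAction {
  mact1 : forall x, alpha 1 x = x;
  mactM : forall y y' x, alpha (y * y') x = alpha y (alpha y' x);
  mact_1 : forall y, alpha y 1 = 1;
  mact_M : forall y x x', alpha y (x * x') = alpha y x * alpha y x'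
}.

(* An alias of X * Y, to carry the monoid structure twisted by alpha. *)
Definition semidirect (X Y : monoidType) (alpha : Y -> X -> X)
  of is_monoid_action alpha : Type := (X * Y)%type.

Section Semidirect.
Context {X Y : monoidType} {alpha : Y -> X -> X}.
Variable alphaP : is_monoid_action alpha.

HB.instance Definition _ := Choice.copy (semidirect alphaP) (X * Y)%type.

Definition semidirect_mul (u v : semidirect alphaP) : semidirect alphaP :=
  (u.1 * alpha u.2 v.1, u.2 * v.2).

Definition semidirect_one : semidirect alphaP := (1, 1).

Fact semidirect_mulA : associative semidirect_mul.
Proof.
case=> [x1 y1] [x2 y2] [x3 y3]; congr pair => /=.
  by rewrite (mact_M alphaP) (mactM alphaP) mulgA.
by rewrite mulgA.
Qed.

Fact semidirect_mul1g : left_id semidirect_one semidirect_mul.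
Proof. by case=> [x y]; rewrite /semidirect_mul /= (mact1 alphaP) !mul1g. Qed.

Fact semidirect_mulg1 : right_id semidirect_one semidirect_mul.
Proof. by case=> [x y]; rewrite /semidirect_mul /= (mact_1 alphaP) !mulg1. Qed.

HB.instance Definition _ := isMonoid.Build (semidirect alphaP)
  semidirect_mulA semidirect_mul1g semidirect_mulg1.

Definition iota1 (x : X) : semidirect alphaP := (x, 1).
Definition iota2 (y : Y) : semidirect alphaP := (1, y).
Definition pi2 (u : semidirect alphaP) : Y := u.2.

End Semidirect.

(* Main.v *)
Require Import Defs.
From HB Require Import structures.
From mathcomp Require Import all_boot all_order monoid.
From mathcomp Require Import boolp classical_sets.

Set Implicit Arguments.
Unset Strict Implicit.
Unset Printing Implicit Defensive.

(** The relation [c] enters the definition of a U-Schreier split extension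
    through three comparisons only: [a] is the restriction of [c] along [iota1],
    [pi2] is a functor to [b], and [iota2] is a functor from [b]. Apart from the
    assumption that [a], [b] and [c] are V-monoid structures, the rest of the
    definition is pure monoid theory, and holds for every semidirect product.

    The functor conditions on [iota1] and [iota2] together amount to the lower
    bound on [c]. Since (x, y) = (x, 1) (1, y), compatibility of [c]
    with the multiplication gives
      a(x,x') * b(y,y') <= c((x,1),(x',1)) * c((1,y),(1,y'))
                        <= c((x,y),(x',y'));
    conversely the unit is below b(1,1) and a(1,1), so that the lower bound,
    evaluated on either factor, returns the two functor conditions.

    The functor condition on [pi2] and the other half of the kernel equation
    amount to the upper bound: [wlex a b] is by definition [a] on the fibre of 1
    and [b] elsewhere. What remains is that [wlex a b] is below [b] on the fibre
    of 1 too, and this is where k = top is used: there b(1,1) = k is the top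
    element. *)

Import Order.TTheory.

Local Open Scope classical_set_scope.
Local Open Scope group_scope.

Section QuantaleOrder.
Context {d : Order.disp_t} {V : quantaleType d}.
Implicit Types x y z t : V.

Lemma le_supremums_pair x y : (x <= y)%O -> supremums [set x; y] y.
Proof.
move=> lexy; split; first by move=> z /= [->|->].
by move=> z; apply; right.
Qed.

(** A map that preserves joins is monotone, because x <= y says that y is the
    join of x and y; this is applied to the translations on either side. *)
Lemma quantale_lemul2l z x y : (x <= y)%O -> (z * x <= z * y)%O.
Proof.
by move=> /le_supremums_pair /(mulg_supremumsr z) [ub _]; apply: ub; exists x; [left|].
Qed.

Lemma quantale_lemul2r z x y : (x <= y)%O -> (x * z <= y * z)%O.
Proof.
by move=> /le_supremums_pair /(mulg_supremumsl z) [ub _]; apply: ub; exists x; [left|].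
Qed.

Lemma quantale_lemul x y z t : (x <= y)%O -> (z <= t)%O -> (x * z <= y * t)%O.
Proof.
by move=> lexy lezt; exact: le_trans (quantale_lemul2r z lexy) (quantale_lemul2l y lezt).
Qed.

End QuantaleOrder.

Section SemidirectMonoid.
Context {X Y : monoidType} {alpha : Y -> X -> X}.
Variable alphaP : is_monoid_action alpha.

Lemma iota1_monoid_morphism : monoid_morphism (iota1 alphaP).
Proof.
split=> // x x'; apply: (congr2 pair) => /=; first by rewrite (mact1 alphaP).
by rewrite mulg1.
Qed.

Lemma iota2_monoid_morphism : monoid_morphism (iota2 alphaP).
Proof.
by split=> // y y'; apply: (congr2 pair) => //=; rewrite (mact_1 alphaP) mulg1.
Qed.

Lemma pi2_monoid_morphism : monoid_morphism (@pi2 X Y alpha alphaP).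
Proof. by []. Qed.

Lemma mul_iota1_iota2 x y : iota1 alphaP x * iota2 alphaP y = (x, y).
Proof.
apply: (congr2 pair) => /=; first by rewrite (mact_1 alphaP) mulg1.
by rewrite mul1g.
Qed.

Lemma range_iota1 : range (iota1 alphaP) = [set z | pi2 z = 1].
Proof.
by apply/seteqP; split=> [_ [x _ <-]|[x y] /= yE] //; exists x => //; rewrite /iota1 -yE.
Qed.

(** By [mul_iota1_iota2] the first coordinate of iota1 (q z) * iota2 (pi2 z) is
    q z, so the only Schreier retraction is the first projection. *)
Lemma semidirect_unique_retraction : exists! q : semidirect alphaP -> X,
  forall z, z = iota1 alphaP (q z) * iota2 alphaP (pi2 z).
Proof.
exists fst; split=> [[x y]|q qP]; first by rewrite mul_iota1_iota2.
by apply/funext => z; rewrite {1}(qP z) mul_iota1_iota2.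
Qed.

End SemidirectMonoid.

Section Bounds.
Context {d : Order.disp_t} {V : quantaleType d} {X Y : monoidType}.
Variables (a : vrel V X) (b : vrel V Y).

(** The inequality is only at stake on the fibre of 1, where reflexivity forces
    [b 1 1] to be the top element. *)
Lemma wlex_le_codomain : (1 : V) = \top%O -> is_vcategory b ->
  forall u v, (wlex a b u v <= b u.2 v.2)%O.
Proof.
move=> V_integral bP u v; rewrite /wlex; case: ifP => // /andP[/eqP -> /eqP ->].
by apply: le_trans (vcat_refl bP 1); rewrite V_integral lex1.
Qed.

Variables (alpha : Y -> X -> X) (alphaP : is_monoid_action alpha).
Variable c : vrel V (semidirect alphaP).

Lemma tensor_rel_le_semidirect : is_vmonoid c ->
    is_vfunctor a c (iota1 alphaP) -> is_vfunctor b c (iota2 alphaP) ->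
  vrel_le (tensor_rel a b) c.
Proof.
move=> cP ac bc [x y] [x' y']; rewrite -!(mul_iota1_iota2 alphaP).
apply: le_trans (vmonoid_mulg cP _ _ _ _).
by rewrite /tensor_rel !mul_iota1_iota2; apply: quantale_lemul; [exact: ac|exact: bc].
Qed.

Lemma semidirect_le_wlex :
    (forall x x', a x x' = c (iota1 alphaP x) (iota1 alphaP x')) ->
    is_vfunctor c b (@pi2 X Y alpha alphaP) ->
  vrel_le c (wlex a b).
Proof.
move=> acE cb [x y] [x' y']; rewrite /wlex /=.
by case: ifP => [/andP[/eqP -> /eqP ->]|_]; [rewrite acE|exact: cb].
Qed.

Lemma iota1_vfunctor : is_vcategory b -> vrel_le (tensor_rel a b) c ->
  is_vfunctor a c (iota1 alphaP).
Proof.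
move=> bP abc x x'; apply: le_trans (abc (x, 1) (x', 1)).
rewrite /tensor_rel /= -[leLHS]mulg1.
exact: quantale_lemul2l (vcat_refl bP 1).
Qed.

Lemma iota2_vfunctor : is_vcategory a -> vrel_le (tensor_rel a b) c ->
  is_vfunctor b c (iota2 alphaP).
Proof.
move=> aP abc y y'; apply: le_trans (abc (1, y) (1, y')).
rewrite /tensor_rel /= -[leLHS]mul1g.
exact: quantale_lemul2r (vcat_refl aP 1).
Qed.

Lemma iota1_full : is_vcategory b ->
    vrel_le (tensor_rel a b) c -> vrel_le c (wlex a b) ->
  forall x x', a x x' = c (iota1 alphaP x) (iota1 alphaP x').
Proof.
move=> bP abc cw x x'; apply: le_anti; rewrite (iota1_vfunctor bP abc) /=.
by have := cw (x, 1) (x', 1); rewrite /wlex /= !eqxx.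
Qed.

End Bounds.

Theorem proposition4p5 (d : Order.disp_t) (V : quantaleType d)
    (V_comm : commutative ( *%g : V -> V -> V))
    (V_integral : (1%g : V) = \top%O)
    (X Y : monoidType) (a : vrel V X) (b : vrel V Y)
    (aP : is_vmonoid a) (bP : is_vmonoid b)
    (alpha : Y -> X -> X) (alphaP : is_monoid_action alpha)
    (c : vrel V (X * Y))
    (cP : is_vmonoid (c : vrel V (semidirect alphaP))) :
  is_uschreier_split_extension a (c : vrel V (semidirect alphaP)) b
    (iota1 alphaP) (@pi2 X Y alpha alphaP) (iota2 alphaP)
  <->
  vrel_le (tensor_rel a b) c /\ vrel_le c (wlex a b).
Proof.
have [aC bC] := (vmonoid_vcat aP, vmonoid_vcat bP).
split=> [[_ _ _ [ac _] [cb _] [bc _] _ [_ _ _ acE] _]|[abc cw]].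
  split; first exact: tensor_rel_le_semidirect cP ac bc.
  exact: semidirect_le_wlex acE cb.
have i1M := iota1_monoid_morphism alphaP.
split=> //.
- by split=> //; exact: iota1_vfunctor bC abc.
- split; last exact: pi2_monoid_morphism.
  by move=> u v; exact: le_trans (cw u v) (wlex_le_codomain a V_integral bC u v).
- by split; [exact: iota2_vfunctor aC abc|exact: iota2_monoid_morphism].
- split=> //.
  + by move=> x x' [].
  + exact: range_iota1.
  + exact: iota1_full bC abc cw.
- exact: semidirect_unique_retraction.
Qed.
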